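(* Let $X_1,\dots,X_k$ be unilateral Fréchet sequence spaces in which $(e_n)_{n\in\mathbb{N}_0}$ is a basis, and let $B_1,\dots,B_k$ be the backward shifts on $X_1,\dots,X_k$ respectively. Let $\mathcal{F}$ be a family. Then the following assertions are equivalent: (1) $\bigoplus_{i=1}^kB_i$ is $\mathcal{F}$-transitive; (2) $\bigoplus_{i=1}^kB_i$ is $\mathcal{F}$-mixing; (3) $\bigoplus_{i=1}^kB_i$ satisfies the $\mathcal{F}$-Mixing Criterion; (4) for each $\epsilon>0$ and $N\in\mathbb{N}$, $\bigcap_{j=0}^N\bigcap_{i=1}^kC_{\epsilon,j}(X_i)\in\mathcal{F}$, where for $j\in\mathbb{N}_0$ and $i\in\{1,\dots,k\}$, \[ C_{\epsilon,j}(X_i)=\{n\in\mathbb{N}_0:\|e_{n+j}\|_{X_i}<\epsilon\}. \]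
   Context: $\mathbb{N}_0$ is the set of non-negative integers, $\mathbb{K}=\mathbb{R}$ or $\mathbb{C}$. A (Furstenberg) family is a collection $\mathcal{F}$ of subsets of $\mathbb{N}_0$ that is hereditary upward ($A\in\mathcal{F}$, $A\subset B\subset\mathbb{N}_0$ imply $B\in\mathcal{F}$), with the conventions $\mathcal{F}\ne\emptyset$ and $\emptyset\notin\mathcal{F}$. A unilateral Fréchet sequence space is an infinite-dimensional separable Fréchet space $X$ which is a linear subspace of $\mathbb{K}^{\mathbb{N}_0}$ with continuous inclusion, where $\mathbb{K}^{\mathbb{N}_0}$ has the product topology; $\|\cdot\|_X$ denotes a fixed F-norm defining the topology of $X$ (i.e. $\|x+y\|\le\|x\|+\|y\|$; $\|\lambda x\|\le\|x\|$ for $|\lambda|\le1$; $\|\lambda x\|\to0$ as $\lambda\to0$; $\|x\|=0$ only for $x=0$). $e_n=(\delta_{i,n})_{i\in\mathbb{N}_0}$ are the canonical unit sequences; that $(e_n)_{n\in\mathbb{N}_0}$ is a basis of $X$ means all $e_n\in X$ and $x=\sum_{n=0}^\infty x_ne_n$ in $X$ for each $x=(x_n)_{n}\in X$. The backward shift on $X$ is $B(x_0,x_1,x_2,\dots)=(x_1,x_2,\dots)$, assumed to map $X$ into $X$ (it is then continuous). An operator is a continuous linear self-map of an infinite-dimensional separable Fréchet space. For an operator $T$ on $X$ and $U,V\subset X$, $N_T(U,V)=\{n\in\mathbb{N}_0: T^nU\cap V\ne\emptyset\}$. $T$ is $\mathcal{F}$-transitive if $N_T(U,V)\in\mathcal{F}$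 for all non-empty open $U,V\subset X$, and $\mathcal{F}$-mixing if $T\oplus T$ is $\mathcal{F}$-transitive. $\mathcal{F}\text{-}\lim_{n\to\infty}z_n=z$ means $\{n\in\mathbb{N}_0:z_n\in U\}\in\mathcal{F}$ for every neighborhood $U$ of $z$. $T$ satisfies the $\mathcal{F}$-Mixing Criterion if there exist dense subsets $X_0,Y_0$ of $X$ and maps $S_n\colon Y_0\to X$ ($n\in\mathbb{N}_0$) such that $\mathcal{F}\text{-}\lim_{n\to\infty}(T^nx_0,S_ny_0,T^nS_ny_0)=(0,0,y_0)$ in $X^3$ for all $x_0\in X_0$, $y_0\in Y_0$. *)

(* Defs.v *)
From HB Require Import structures.
From mathcomp Require Import all_boot all_order all_algebra.
From mathcomp Require Import complex.
From mathcomp Require Import all_classical all_reals all_analysis.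

Set Implicit Arguments.
Unset Strict Implicit.
Unset Printing Implicit Defensive.

Import Order.TTheory GRing.Theory Num.Theory.
Import numFieldNormedType.Exports.

Local Open Scope classical_set_scope.
Local Open Scope ring_scope.

Definition real_or_complex (R : realType) (K : numFieldType) : Prop :=
  K = R :> numFieldType \/ K = R[i]%C :> numFieldType.

Definition furstenberg_family (F : set (set nat)) : Prop :=
  [/\ F !=set0, ~ F set0 & forall A B, F A -> A `<=` B -> F B].

Section FrechetSpaces.
Variables (R : realType) (K : numFieldType).

(* Nonnegativity of N and N 0 = 0 follow from these axioms. *)
Definition F_norm (X : lmodType K) (N : X -> R) : Prop :=
  [/\ forall x y, N (x + y) <= N x + N y,
      forall (a : K) x, `|a| <= 1 -> N (a *: x) <= N x,
      forall x, N (a *: x) @[a --> (0 : K)] --> (0 : R)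
    & forall x, N x = 0 -> x = 0].

Definition F_norm_defines_topology (X : tvsType K) (N : X -> R) : Prop :=
  forall (x : X) (U : set X),
    nbhs x U <-> exists2 eps : R, 0 < eps & [set y | N (y - x) < eps] `<=` U.

(* Completeness is stated through the F-norm because the uniform structure
   carried by a [tvsType] induces its topology but need not be the
   translation-invariant one. *)
Definition F_norm_complete (X : tvsType K) (N : X -> R) : Prop :=
  forall u : nat -> X,
    (forall eps : R, 0 < eps -> exists m : nat, forall p q : nat,
       (m <= p)%N -> (m <= q)%N -> N (u p - u q) < eps) ->
    exists l : X, u n @[n --> \oo] --> l.

(* Local convexity is part of [tvsType]; Hausdorffness follows from
   definiteness of the F-norm. *)
Definition frechet_space (X : tvsType K) (N : X -> R) : Prop :=
  [/\ F_norm N, F_norm_defines_topology N & F_norm_complete N].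

Definition separable_space (X : topologicalType) : Prop :=
  exists2 D : set X, countable D & dense D.

Definition infinite_dimensional (X : lmodType K) : Prop :=
  ~ exists (n : nat) (v : 'I_n -> X),
      forall x : X, exists c : 'I_n -> K, x = \sum_(i < n) c i *: v i.

(* A linear subspace of K^nat with its own topology is encoded as a space
   together with its inclusion map [coords]. *)
Record frechet_seq_space := FrechetSeqSpace {
  fss_tvs :> tvsType K;
  Fnorm : fss_tvs -> R;
  coords : {linear fss_tvs -> (nat -> K)};
  fss_frechet : frechet_space Fnorm;
  fss_separable : separable_space fss_tvs;
  fss_infinite_dimensional : infinite_dimensional fss_tvs;
  coords_inj : injective coords;
  coords_continuous : continuous (coords : fss_tvs -> {ptws nat -> K})
}.

Arguments coords {f}.

Definition unit_sequence (n : nat) : nat -> K := fun m => (m == n)%:R.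

Definition canonical_basis (X : frechet_seq_space) (e : nat -> X) : Prop :=
  (forall n, coords (e n) = unit_sequence n) /\
  (forall x : X,
     \sum_(0 <= n < m) coords x n *: e n @[m --> \oo] --> x).

Definition backward_shift (X : frechet_seq_space) (B : X -> X) : Prop :=
  forall (x : X) (n : nat), coords (B x) n = coords x n.+1.

Definition C_set (X : frechet_seq_space) (e : nat -> X) (eps : R) (j : nat) :
  set nat := [set n | Fnorm (e (n + j)%N) < eps].

End FrechetSpaces.

Arguments coords {R K f}.

Section DirectSum.
Variables (K : numFieldType) (k : nat) (X : 'I_k -> tvsType K).

Definition direct_sum : Type := prod_topology (fun i => X i).

HB.instance Definition _ :=
  Topological.copy direct_sum (prod_topology (fun i => X i)).

Implicit Types x y z : direct_sum.

Let add x y : direct_sum := fun i => x i + y i.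
Let opp x : direct_sum := fun i => - x i.
Let zero : direct_sum := fun i => 0.
Let scale (a : K) x : direct_sum := fun i => a *: x i.

Let addA : associative add.
Proof. by move=> x y z; apply: functional_extensionality_dep => i; exact: addrA. Qed.
Let addC : commutative add.
Proof. by move=> x y; apply: functional_extensionality_dep => i; exact: addrC. Qed.
Let add0 : left_id zero add.
Proof. by move=> x; apply: functional_extensionality_dep => i; exact: add0r. Qed.
Let addN : left_inverse zero opp add.
Proof. by move=> x; apply: functional_extensionality_dep => i; exact: addNr. Qed.

HB.instance Definition _ := GRing.isZmodule.Build direct_sum addA addC add0 addN.

Let scaleA a b x : scale a (scale b x) = scale (a * b) x.
Proof. by apply: functional_extensionality_dep => i; exact: scalerA. Qed.
Let scale1 : left_id 1 scale.
Proof. by move=> x; apply: functional_extensionality_dep => i; exact: scale1r. Qed.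
Let scaleDr : right_distributive scale +%R.
Proof. by move=> a x y; apply: functional_extensionality_dep => i; exact: scalerDr. Qed.
Let scaleDl x : {morph scale^~ x : a b / a + b}.
Proof. by move=> a b; apply: functional_extensionality_dep => i; exact: scalerDl. Qed.

HB.instance Definition _ :=
  GRing.Zmodule_isLmodule.Build K direct_sum scaleA scale1 scaleDr scaleDl.

Definition direct_sum_map (T : forall i, X i -> X i) :
  direct_sum -> direct_sum := fun x i => T i (x i).

End DirectSum.

Section Dynamics.
Variable F : set (set nat).

Definition return_set (X : Type) (T : X -> X) (U V : set X) : set nat :=
  [set n | (iter n T @` U) `&` V !=set0].

Definition F_transitive (X : topologicalType) (T : X -> X) : Prop :=
  forall U V : set X, open U -> U !=set0 -> open V -> V !=set0 ->
    F (return_set T U V).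

Definition F_mixing (X : topologicalType) (T : X -> X) : Prop :=
  F_transitive (fun p : X * X => (T p.1, T p.2)).

Definition F_lim (X : topologicalType) (z : nat -> X) (l : X) : Prop :=
  forall U : set X, nbhs l U -> F [set n | U (z n)].

(* Only the values of S n on Y0 matter. *)
Definition F_mixing_criterion (K : numFieldType) (X : preTopologicalLmodType K)
    (T : X -> X) : Prop :=
  exists (X0 Y0 : set X) (S : nat -> X -> X),
    [/\ dense X0, dense Y0 &
        forall x y, X0 x -> Y0 y ->
          F_lim (fun n => (iter n T x, S n y, iter n T (S n y))) (0, 0, y)].

End Dynamics.

(* Main.v *)
(** The sets in (4) generate a filter G on the natural numbers, and (4) says
   exactly that G is contained in F.

   (4) implies the dynamical properties: along G every unit vector [e (n + m)]
   tends to 0, so for finitely supported [x] and [y] with forward shifts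
   [S_n y] one has [x + S_n y --> x], while [B^n (x + S_n y) = y] for large [n].
   Being a limit along a genuine filter, this holds simultaneously for two pairs
   (x, y), which gives mixing.

   Conversely, Banach--Steinhaus makes the coordinate projections
   [x |-> x_n e_n] equicontinuous, so there is a neighborhood W of 0 such that,
   if [w] is in W and the first coordinates of [B^n w] are close to 1, then the
   vectors [e (n + j)], [j <= N], are small. *)

From HB Require Import structures.
Require Import Defs.
From mathcomp Require Import all_boot all_order all_algebra.
From mathcomp Require Import all_classical all_reals all_analysis.
From mathcomp Require Import ring lra.

Set Implicit Arguments.
Unset Strict Implicit.
Unset Printing Implicit Defensive.

Import Order.TTheory GRing.Theory Num.Theory.
Import numFieldNormedType.Exports.

Local Open Scope classical_set_scope.
Local Open Scope ring_scope.

(** * Elementary consequences of the F-norm axioms *)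

Section FNorm.
Variables (R : realType) (K : numFieldType) (X : lmodType K) (N : X -> R).
Hypothesis hN : F_norm N.

Lemma F_norm_scale_near0 x (eps : R) :
  0 < eps -> \forall a \near (0 : K), N (a *: x) < eps.
Proof.
move=> e0; have [_ _ /(_ x) Nx _] := hN.
have /cvgr0Pnorm_lt/(_ _ e0) := Nx.
by apply: filterS => a; apply: le_lt_trans; exact: ler_norm.
Qed.

(** Subadditivity at [0] gives [0 <= N 0]; scalars near [0] fix the zero vector, so [N 0] lies below
    every positive [eps]. *)
Lemma F_norm0 : N 0 = 0.
Proof.
have N00 : 0 <= N 0.
  have [/(_ 0 0) + _ _ _] := hN; rewrite addr0 => ND.
  lra.
apply/eqP; rewrite eq_le N00 andbT; apply/ler_addgt0Pr => eps e0.
rewrite add0r -{1}(scaler0 X 0) ltW//.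
exact: nbhs_singleton (F_norm_scale_near0 0 e0).
Qed.

Lemma F_norm_ge0 x : 0 <= N x.
Proof.
by have [_ /(_ 0 x) + _ _] := hN; rewrite scale0r normr0 F_norm0; apply.
Qed.

Lemma F_normN x : N (- x) = N x.
Proof.
have le_N y : N (- y) <= N y.
  by have [_ /(_ (-1) y) + _ _] := hN; rewrite normrN1 scaleN1r; apply.
by apply/eqP; rewrite eq_le le_N -{1}[x]opprK le_N.
Qed.

Lemma F_norm_gt0 x : x != 0 -> 0 < N x.
Proof.
move=> x0; rewrite lt_neqAle F_norm_ge0 andbT eq_sym.
by apply: contra x0 => /eqP Nx; have [_ _ _ /(_ x Nx) ->] := hN.
Qed.

Lemma F_normD x y : N (x + y) <= N x + N y.
Proof. by have [+ _ _ _] := hN; apply. Qed.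

Lemma F_normB x y : N (x - y) <= N x + N y.
Proof. by rewrite -[N y]F_normN F_normD. Qed.

Lemma F_norm_distC x y : N (x - y) = N (y - x).
Proof. by rewrite -F_normN opprB. Qed.

Lemma F_norm_dist_triangle y x z : N (x - z) <= N (x - y) + N (y - z).
Proof. by rewrite -[x - z](subrKA y) F_normD. Qed.

End FNorm.

(** * Baire category and Banach--Steinhaus in Fréchet spaces *)

Section FrechetTopology.
Variables (R : realType) (K : numFieldType) (X : tvsType K) (N : X -> R).
Hypothesis hX : frechet_space N.

Lemma frechet_nbhsP (x : X) (U : set X) :
  nbhs x U <-> exists2 eps : R, 0 < eps & [set y | N (y - x) < eps] `<=` U.
Proof. by case: hX. Qed.

Lemma frechet_nbhs_ball (x : X) (eps : R) :
  0 < eps -> nbhs x [set y | N (y - x) < eps].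
Proof. by move=> e0; apply/frechet_nbhsP; exists eps. Qed.

Lemma frechet_cvg_sequenceP (u : nat -> X) (l : X) :
  u n @[n --> \oo] --> l <->
  forall eps : R, 0 < eps ->
    exists m, forall n, (m <= n)%N -> N (u n - l) < eps.
Proof.
split=> [ul eps e0|ul U /frechet_nbhsP[eps e0 eU]].
  have [m _ mP] := ul _ (frechet_nbhs_ball l e0).
  by exists m => n mn; exact: mP.
by have [m mP] := ul _ e0; exists m => // n mn; apply: eU; exact: mP.
Qed.

(* Baire's argument: if every tail family [T n, n >= m] were unbounded by [eps]
   on every ball, nested balls would produce a point [l] with
   [N (T n l) > eps] for infinitely many [n]. *)
Lemma pointwise_cvg0_bounded_ball (T : nat -> {linear X -> X}) (eps : R) :
  (forall n (eta : R), 0 < eta ->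
     exists2 delta : R, 0 < delta & forall x, N x < delta -> N (T n x) < eta) ->
  (forall x, exists m, forall n, (m <= n)%N -> N (T n x) <= eps) ->
  exists m x (r : R), 0 < r /\
    forall y n, N (y - x) < r -> (m <= n)%N -> N (T n y) <= eps.
Proof.
have [hN hT hC] := hX.
move=> Tcont Tcvg; apply: contrapT => noball.
have step m (s : X * {posnum R}) : exists s' : X * {posnum R},
    [/\ N (s'.1 - s.1) + s'.2%:num <= s.2%:num,
        s'.2%:num <= s.2%:num / 2 &
        exists2 n, (m <= n)%N &
          forall z, N (z - s'.1) <= s'.2%:num -> eps < N (T n z)].
  case: s => x r.
  have [y [n [yr mn Tny]]] : exists y n,
      [/\ N (y - x) < r%:num, (m <= n)%N & eps < N (T n y)].
    apply: contrapT => nex; apply: noball; exists m, x, r%:num; split => //.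
    move=> y n yr mn; rewrite leNgt; apply/negP => Tny.
    by apply: nex; exists y, n.
  have /(Tcont n)[delta d0 dP] : 0 < N (T n y) - eps by rewrite subr_gt0.
  (* The three bounds keep [N (T n z)] above [eps] on the new closed ball, nest that ball in the old
     one, and at least halve the radius. *)
  pose r' := Num.min (delta / 2) (Num.min (r%:num - N (y - x)) (r%:num / 2)).
  have r0 : 0 < r%:num by [].
  have r'0 : 0 < r' by rewrite !lt_min; apply/and3P; split; lra.
  have [r'1 r'2 r'3] : [/\ r' <= delta / 2, r' <= r%:num - N (y - x)
      & r' <= r%:num / 2] by split; rewrite /r' !ge_min lexx ?orbT.
  exists (y, PosNum r'0); split => //=; first by lra.
  exists n => // z zr'.
  have : N (T n y - T n z) < N (T n y) - eps.
    rewrite -linearB; apply: dP; rewrite (F_norm_distC hN); lra.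
  have := F_normD hN (T n y - T n z) (T n z).
  by rewrite subrK; lra.
have [g gP] := choice (fun ms : nat * _ => step ms.1 ms.2).
(* Stage [p] is run with [m := p], so the indices [n] at which [T n] is large tend to infinity. *)
pose s := fix s p : X * {posnum R} := if p is p'.+1 then g (p', s p') else (0, PosNum (@ltr01 R)).
pose x p := (s p).1; pose r p := (s p).2%:num.
have r_gt0 p : 0 < r p by rewrite /r.
have xr p : N (x p.+1 - x p) + r p.+1 <= r p by have [] := gP (p, s p).
have rhalf p : r p.+1 <= r p / 2 by have [] := gP (p, s p).
have rle p : r p <= 2 ^- p.
  elim: p => [|p IH]; first by rewrite expr0 invr1.
  by apply: (le_trans (rhalf p)); rewrite exprSr invfM ler_pM2r.
have nested p q : (p <= q)%N -> N (x q - x p) + r q <= r p.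
  elim: q => [|q IH].
    by rewrite leqn0 => /eqP ->; rewrite subrr (F_norm0 hN) add0r lexx.
  rewrite leq_eqVlt => /predU1P[->|]; first by rewrite subrr (F_norm0 hN) add0r lexx.
  rewrite ltnS => /IH; have := xr q.
  have := F_norm_dist_triangle hN (x q) (x q.+1) (x p); lra.
have [l xl] : exists l : X, x n @[n --> \oo] --> l.
  apply: hC => eta eta0.
  have [m rm] : exists m, r m < eta / 2.
    have [m _ /(_ m (leqnn m))] :=
      near_infty_natSinv_expn_lt (PosNum (divr_gt0 eta0 (ltr0Sn R 1))).
    by rewrite /= div1r => rm; exists m; exact: le_lt_trans (rle m) rm.
  exists m => p q mp mq.
  have := nested _ _ mp; have := nested _ _ mq.
  have := F_norm_dist_triangle hN (x m) (x p) (x q).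
  rewrite (F_norm_distC hN (x m) (x q)).
  have := r_gt0 p; have := r_gt0 q; lra.
(* The limit stays in every closed ball: compare it with a center that is both past [p] and close to
   [l]. *)
have lr p : N (l - x p) <= r p.
  apply/ler_addgt0Pr => eta eta0.
  have /frechet_cvg_sequenceP/(_ _ eta0)[q qP] := xl.
  have := qP _ (leq_maxl q p); have := nested _ _ (leq_maxr q p).
  have := F_norm_dist_triangle hN (x (maxn q p)) l (x p).
  rewrite (F_norm_distC hN l (x (maxn q p))).
  have := r_gt0 (maxn q p); lra.
have [m mP] := Tcvg l.
have [_ _ [n mn /(_ l (lr m.+1))]] := gP (m, s m).
by rewrite ltNge mP.
Qed.

(* Banach--Steinhaus. *)
Lemma pointwise_cvg0_equicontinuous (T : nat -> {linear X -> X}) (eps : R) :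
  (forall n (eta : R), 0 < eta ->
     exists2 delta : R, 0 < delta & forall x, N x < delta -> N (T n x) < eta) ->
  (forall x, T n x @[n --> \oo] --> 0) ->
  0 < eps ->
  exists2 delta : R, 0 < delta & forall x n, N x < delta -> N (T n x) < eps.
Proof.
have [hN hT hC] := hX.
(* A third rather than a half: the non-strict ball bound is used twice, and the conclusion is
   strict. *)
move=> Tcont Tcvg e0; have e3 : 0 < eps / 3 by lra.
have [|m [x [r [r0 Tball]]]] := pointwise_cvg0_bounded_ball (eps := eps / 3) Tcont.
  move=> x; have /frechet_cvg_sequenceP/(_ _ e3)[m mP] := Tcvg x.
  by exists m => n mn; rewrite -[T n x]subr0 ltW// mP.
(* The finitely many maps before [m] are handled by their individual continuity. *)
have [d d0 dP] : exists2 d : R, 0 < d &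
    forall x n, N x < d -> (n < m)%N -> N (T n x) < eps.
  elim: m {Tball} => [|m [d d0 dP]]; first by exists 1.
  have [d' d'0 d'P] := Tcont m _ e0.
  exists (Num.min d d'); first by rewrite lt_min d0.
  move=> y n; rewrite lt_min ltnS leq_eqVlt => /andP[yd yd'] /predU1P[->|].
    exact: d'P.
  exact: dP.
exists (Num.min d r); first by rewrite lt_min d0.
move=> y n; rewrite lt_min => /andP[yd yr].
have [nm|mn] := ltnP n m; first exact: dP.
(* Linearity moves the ball from [x] to [0]: [T n y = T n (y + x) - T n x]. *)
have := Tball (y + x) n; rewrite addrK => /(_ yr mn).
have := Tball x n; rewrite subrr (F_norm0 hN) => /(_ r0 mn).
have := F_normB hN (T n (y + x)) (T n x); rewrite linearD addrK; lra.
Qed.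

End FrechetTopology.

(** * Limits along a filter in topological vector spaces *)

Lemma cvg0Z (K : numFieldType) (X : tvsType K) (T : Type) (G : set_system T)
    (FG : Filter G) (a : K) (u : T -> X) :
  u t @[t --> G] --> 0 -> a *: u t @[t --> G] --> 0.
Proof.
move=> u0 U U0; suff : \forall t \near G, U (a *: u t) by [].
have [->|a0] := eqVneq a 0.
  by apply: filterE => t; rewrite scale0r; exact: nbhs_singleton.
have : \forall t \near G, ( *:%R a^-1 @` U) (u t).
  exact: u0 _ (nbhs0Z (invr_neq0 a0) U0).
by apply: filterS => t [v Uv /= <-]; rewrite scalerA divff// scale1r.
Qed.

Lemma cvg_tvsD (K : numFieldType) (X : tvsType K) (T : Type) (G : set_system T)
    (FG : Filter G) (u v : T -> X) (a b : X) :
  u t @[t --> G] --> a -> v t @[t --> G] --> b ->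
  u t + v t @[t --> G] --> a + b.
Proof.
by move=> ua vb; apply: continuous2_cvg => //; exact: (@add_continuous X (a, b)).
Qed.

(** * Coordinate projections and shifts on a single sequence space *)

Section SequenceSpace.
Variables (R : realType) (K : numFieldType) (X : frechet_seq_space R K).
Variables (e : nat -> X) (he : canonical_basis e).

Let hX : frechet_space (@Fnorm _ _ X) := fss_frechet X.
Let hN : F_norm (@Fnorm _ _ X). Proof. by case: hX. Qed.

Lemma coordsD (x y : X) n : coords (x + y) n = coords x n + coords y n.
Proof. by rewrite linearD. Qed.

Lemma coordsZ (a : K) (x : X) n : coords (a *: x) n = a * coords x n.
Proof. by rewrite linearZ. Qed.

Lemma coords0 n : coords (0 : X) n = 0.
Proof. by rewrite linear0. Qed.

Lemma coords_ext (x y : X) : (forall n, coords x n = coords y n) -> x = y.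
Proof. by move=> xy; apply: (@coords_inj _ _ X); apply/funext. Qed.

Lemma coords_sum I (r : seq I) (P : pred I) (u : I -> X) n :
  coords (\sum_(i <- r | P i) u i) n = \sum_(i <- r | P i) coords (u i) n.
Proof.
by apply: (big_morph (fun x : X => coords x n)) => [x y|];
  [exact: coordsD|exact: coords0].
Qed.

Lemma coords_unit m n : coords (e m) n = (n == m)%:R.
Proof. by have [-> _] := he. Qed.

Lemma unit_neq0 n : e n != 0.
Proof.
apply/eqP => /(congr1 (fun x : X => coords x n)).
by rewrite coords0 coords_unit eqxx => /eqP; rewrite oner_eq0.
Qed.

Lemma coord_continuous n : continuous (fun x : X => coords x n : K).
Proof.
move=> x; exact: (continuous_comp (@coords_continuous _ _ X x)
  (@proj_continuous nat (fun=> K) n (coords x))).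
Qed.

Definition coord_proj n (x : X) : X := coords x n *: e n.

Lemma coord_proj_linear n : linear (coord_proj n).
Proof.
by move=> a x y; rewrite /coord_proj coordsD coordsZ scalerDl scalerA.
Qed.

HB.instance Definition _ n :=
  GRing.isLinear.Build K X X *:%R (coord_proj n) (coord_proj_linear n).

(** The projection is a continuous coordinate functional followed by [a |-> a *: e n], which is
    continuous at [0] by an F-norm axiom. *)
Lemma coord_proj_continuous0 n (eta : R) : 0 < eta ->
  exists2 delta : R, 0 < delta &
    forall x, Fnorm x < delta -> Fnorm (coord_proj n x) < eta.
Proof.
move=> eta0; have : nbhs (0 : X) [set x | Fnorm (coord_proj n x) < eta].
  have := F_norm_scale_near0 hN (e n) eta0; rewrite -(coords0 n) => near0.
  exact: (@coord_continuous n 0 _ near0).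
move=> /(frechet_nbhsP hX)[d d0 dP]; exists d => // x xd.
by apply: dP; rewrite /= subr0.
Qed.

(** The projections of [x] are the differences of consecutive partial sums of its convergent basis
    expansion. *)
Lemma coord_proj_cvg0 (x : X) : coord_proj n x @[n --> \oo] --> 0.
Proof.
apply/(frechet_cvg_sequenceP hX) => eps e0.
have [_ /(_ x)/(frechet_cvg_sequenceP hX)] := he.
have e2 : 0 < eps / 2 by lra.
move=> /(_ _ e2)[m mP]; exists m => n mn; rewrite subr0.
have := mP _ mn; have := mP _ (leqW mn); rewrite big_nat_recr//=.
set s := \sum_(0 <= i < n) _ => h1 h2.
have -> : coord_proj n x = (s + coord_proj n x - x) - (s - x).
  by rewrite opprB addrA subrK addrC addKr.
have := F_normB hN (s + coord_proj n x - x) (s - x); rewrite /coord_proj; lra.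
Qed.

Lemma coord_proj_equicontinuous (eps : R) : 0 < eps ->
  exists2 delta : R, 0 < delta &
    forall x n, Fnorm x < delta -> Fnorm (coord_proj n x) < eps.
Proof.
exact: (pointwise_cvg0_equicontinuous hX coord_proj_continuous0 coord_proj_cvg0).
Qed.

(** An F-norm need not be homogeneous, so dividing by the coordinate [a] needs care. Since [a] has
    modulus at least 1/2, [(2 * a)^-1] has modulus at most 1, and [e n] is the sum of two copies of
    [(2 * a)^-1 *: coord_proj n x], each of F-norm below [eps / 2]. *)
Lemma Fnorm_unit_lt (eps : R) (x : X) n :
  Fnorm (coord_proj n x) < eps / 2 -> `|coords x n - 1| < 2^-1 ->
  Fnorm (e n) < eps.
Proof.
set a := coords x n => xe a1.
have a2 : 2^-1 <= `|a|.
  rewrite -[leLHS](_ : 1 - 2^-1 = _); last by rewrite {1}(splitr 1) mul1r addrK.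
  rewrite lerBlDr; have := ler_normD a (1 - a); rewrite subrKC normr1.
  by move=> /le_trans; apply; rewrite lerD2l distrC ltW.
have a0 : a != 0 by rewrite -normr_gt0 (lt_le_trans _ a2)// invr_gt0.
have -> : e n = (2 * a)^-1 *: coord_proj n x + (2 * a)^-1 *: coord_proj n x.
  rewrite -scalerDl /coord_proj -/a scalerA -[LHS]scale1r; congr (_ *: _).
  field.
  by rewrite a0.
have le1 : `|(2 * a)^-1| <= 1.
  rewrite normfV normrM invf_le1 ?mulr_gt0 ?normr_gt0//.
  by rewrite normr_nat -ler_pdivrMl// mulr1.
have := F_normD hN ((2 * a)^-1 *: coord_proj n x) ((2 * a)^-1 *: coord_proj n x).
have [_ /(_ _ (coord_proj n x) le1) + _ _] := hN.
lra.
Qed.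

Definition finitely_supported (M : nat) (x : X) :=
  forall n, (M <= n)%N -> coords x n = 0.

Definition truncation M (x : X) : X := \sum_(0 <= n < M) coords x n *: e n.

Lemma truncation_finitely_supported M x :
  finitely_supported M (truncation M x).
Proof.
move=> n Mn; rewrite coords_sum big_nat big1// => i /andP[_ iM].
rewrite coordsZ coords_unit gtn_eqF ?mulr0//; exact: leq_trans Mn.
Qed.

(* The right inverse of the [n]-th power of the backward shift, restricted to
   sequences supported in [0, M[. *)
Definition forward_shift M n (x : X) : X :=
  \sum_(m < M) coords x m *: e (n + m)%N.

Lemma forward_shift_cvg0 M (x : X) (G : set_system nat) (FG : Filter G) :
  (forall m, e (n + m)%N @[n --> G] --> 0) ->
  forward_shift M n x @[n --> G] --> 0.
Proof.
move=> e0; rewrite /forward_shift; elim: M => [|M IH].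
  under eq_fun do rewrite big_ord0.
  exact: cvg_cst.
under eq_fun do rewrite big_ord_recr/=.
by have := cvg_tvsD FG IH (cvg0Z FG (coords x M) (e0 M)); rewrite addr0.
Qed.

Variables (B : X -> X) (hB : backward_shift B).

Lemma coords_iter_shift n (x : X) m : coords (iter n B x) m = coords x (n + m)%N.
Proof. by elim: n m => //= n IH m; rewrite hB IH addnS. Qed.

Lemma iter_shiftD n (x y : X) : iter n B (x + y) = iter n B x + iter n B y.
Proof.
by apply: coords_ext => m; rewrite coordsD !coords_iter_shift coordsD.
Qed.

Lemma iter_shift_eq0 M n (x : X) :
  finitely_supported M x -> (M <= n)%N -> iter n B x = 0.
Proof.
move=> xM Mn; apply: coords_ext => m.
by rewrite coords0 coords_iter_shift xM// (leq_trans Mn)// leq_addr.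
Qed.

Lemma iter_shift_forward_shift M n (x : X) :
  finitely_supported M x -> iter n B (forward_shift M n x) = x.
Proof.
move=> xM; apply: coords_ext => m; rewrite coords_iter_shift coords_sum.
have [mM|Mm] := ltnP m M; last first.
  rewrite xM// big1// => i _; rewrite coordsZ coords_unit eqn_add2l.
  by rewrite gtn_eqF ?mulr0// (leq_trans _ Mm).
rewrite (bigD1 (Ordinal mM))//= coordsZ coords_unit eqxx mulr1 big1 ?addr0//.
move=> i im; rewrite coordsZ coords_unit eqn_add2l [m == i]eq_sym.
by rewrite (negbTE (im : (i : nat) != m)) mulr0.
Qed.

End SequenceSpace.

(** * Limits in pairs and in the direct sum *)

Lemma cvg_pair_nbhs (T : Type) (U V : topologicalType) (G : set_system T)
    (FG : Filter G) (f : T -> U) (g : T -> V) (a : U) (b : V) :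
  f t @[t --> G] --> a -> g t @[t --> G] --> b ->
  (f t, g t) @[t --> G] --> (a, b).
Proof. exact: (@cvg_pair _ _ _ G (nbhs a) (nbhs b)). Qed.

Section DirectSumTopology.
Variables (K : numFieldType) (k : nat) (X : 'I_k -> tvsType K).

Lemma direct_sum_cvg (T : Type) (G : set_system T) (FG : Filter G)
    (g : T -> direct_sum X) (l : direct_sum X) :
  (forall i, g t i @[t --> G] --> l i) -> g t @[t --> G] --> l.
Proof.
(* The product topology is the supremum of those induced by the projections. Each projection is
   onto, as [cvg_image] requires: [dfwith] replaces the entry of [l] at [i]. *)
move=> gl; apply/cvg_sup => i; apply/cvg_image.
  rewrite eqEsubset; split=> v // _.
  by exists (dfwith l i v) => //; exact: dfwithin.
move=> U /(gl i) GU; exists (@proj _ X i @^-1` U) => //.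
rewrite eqEsubset; split=> [_ [f Uf <-]//|v Uv].
exists (dfwith l i v); last exact: dfwithin.
by rewrite /= /proj dfwithin.
Qed.

Lemma direct_sum_nbhs_forall (x : direct_sum X) (W : forall i, set (X i)) :
  (forall i, nbhs (x i) (W i)) ->
  nbhs x [set y : direct_sum X | forall i, W i (y i)].
Proof.
move=> xW; apply: (filter_forall (f := fun i (y : direct_sum X) => W i (y i))
  (nbhs_filter x)) => i.
exact: (@proj_continuous _ (fun i => X i) i x (W i) (xW i)).
Qed.

Lemma iter_direct_sum_map (T : forall i, X i -> X i) n (x : direct_sum X) i :
  iter n (direct_sum_map T) x i = iter n (T i) (x i).
Proof. by elim: n => //= n <-. Qed.

End DirectSumTopology.

(** * Small unit vectors and the dynamics of the sum of the shifts *)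

Section Shifts.
Variables (R : realType) (K : numFieldType) (k : nat).
Variables (X : 'I_k -> frechet_seq_space R K).
Variables (e : forall i : 'I_k, nat -> X i).
Hypothesis he : forall i, canonical_basis (e i).
Variables (B : forall i : 'I_k, X i -> X i).
Arguments B : clear implicits.
Hypothesis hB : forall i, backward_shift (B i).
Arguments hB : clear implicits.

Notation D := (direct_sum (fun i => X i)).
Notation BB := (@direct_sum_map K k (fun i => X i) B).

Definition small_units (eps : R) (N : nat) : set nat :=
  \bigcap_(j in [set j : nat | (j <= N)%N])
    \bigcap_(i in [set: 'I_k]) C_set (e i) eps j.

(** Shared by transitivity and the Mixing Criterion, which both produce points of [W] sent into [V].
    Equicontinuity makes [W] a neighborhood although it bounds all coordinate projections at once,
    so that it does not depend on [n]. *)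
Lemma return_small_units (eps : R) N : 0 < eps ->
  exists W V : set D, [/\ nbhs (0 : D) W, exists y : D, nbhs y V &
    forall n w, W w -> V (iter n BB w) -> small_units eps N n].
Proof.
move=> e0; have e2 : 0 < eps / 2 by lra.
pose W : set D :=
  [set w | forall i n, Fnorm (coord_proj (e i) n (w i)) < eps / 2].
pose V : set D :=
  [set v | forall i (j : 'I_N.+1), `|coords (v i) j - 1| < 2^-1].
exists W, V; split.
- apply: (direct_sum_nbhs_forall (W := fun i =>
    [set w | forall n, Fnorm (coord_proj (e i) n w) < eps / 2])) => i.
  have [d d0 dP] := coord_proj_equicontinuous (he i) e2.
  apply/(frechet_nbhsP (fss_frechet (X i))); exists d => // y.
  by rewrite /= subr0 => yd n; exact: dP.
- pose y : D := fun i => \sum_(0 <= j < N.+1) e i j.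
  exists y; apply: (direct_sum_nbhs_forall (W := fun i =>
    [set v | forall j : 'I_N.+1, `|coords v j - 1| < 2^-1])) => i.
  apply: filter_forall => j.
  have yj : coords (y i) j = 1.
    rewrite /y coords_sum big_mkord (bigD1 j)//= big1 => [|m mj].
      by rewrite addr0 (coords_unit (he i)) eqxx.
    by rewrite (coords_unit (he i)) eq_sym (negbTE (mj : (m : nat) != j)).
  have h2 : 0 < 2^-1 :> K by rewrite invr_gt0.
  have := @coord_continuous _ _ (X i) j (y i).
  move=> /cvgrPdist_lt/(_ _ h2); rewrite yj; apply: filterS => v.
  by rewrite distrC.
(* Coordinate [j] of the [n]-th iterate is coordinate [n + j] of [w]: [V] puts it near 1, and [W]
   bounds the projection at that index. *)
- move=> n w Ww Vw j jN i _; apply: (Fnorm_unit_lt (Ww i (n + j)%N)).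
  have jN1 : (j < N.+1)%N by [].
  have := Vw i (Ordinal jN1).
  by rewrite /= iter_direct_sum_map (coords_iter_shift (hB i)).
Qed.

Definition small_units_filter : set_system nat :=
  filter_from [set p : R * nat | 0 < p.1 /\ (0 < p.2)%N]
    (fun p => small_units p.1 p.2).

#[local] Instance small_units_filter_filter : Filter small_units_filter.
Proof.
apply: filter_from_filter; first by exists (1, 1%N); split => /=.
move=> [a n] [b m] /= [a0 n0] [b0 m0].
exists (Num.min a b, maxn n m); first by rewrite /= lt_min a0 b0 leq_max n0.
move=> q qP; split=> j /= jN i _.
  have := qP j (leq_trans jN (leq_maxl _ _)) i I.
  by rewrite /C_set /= lt_min => /andP[].
have := qP j (leq_trans jN (leq_maxr _ _)) i I.
by rewrite /C_set /= lt_min => /andP[].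
Qed.

Lemma unit_cvg0 i m : e i (n + m)%N @[n --> small_units_filter] --> 0.
Proof.
move=> U /(frechet_nbhsP (fss_frechet (X i)))[eps e0 epsU].
(* [m.+1] instead of [m], because the filter base admits only positive indices. *)
exists (eps, m.+1) => //= n nP; apply: epsU; rewrite /= subr0.
by have := nP m (leqnSn m) i I.
Qed.

(* Since no unit vector vanishes, asking [e i n] to be small enough forces [n]
   to be large. *)
Lemma small_units_filter_ge (k0 : (0 < k)%N) m :
  \forall n \near small_units_filter, (m <= n)%N.
Proof.
(* With no summand, every set of small units would be all of [nat] and the filter would not tend to
   infinity. *)
pose i := Ordinal k0.
have Npos n : 0 < Fnorm (e i n).
  apply: F_norm_gt0; first by case: (fss_frechet (X i)).
  exact: (unit_neq0 (he i)).
have [eps e0 epsP] : exists2 eps : R, 0 < eps &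
    forall n, (n < m)%N -> eps <= Fnorm (e i n).
  elim: m => [|m [eps e0 epsP]]; first by exists 1.
  exists (Num.min eps (Fnorm (e i m))); first by rewrite lt_min e0 Npos.
  move=> n; rewrite ltnS leq_eqVlt => /predU1P[->|nm].
    by rewrite ge_min lexx orbT.
  by rewrite ge_min epsP.
exists (eps, 1%N) => //= n /(_ 0%N isT i I).
rewrite /C_set /= addn0 => nlt; rewrite leqNgt; apply/negP => /epsP.
by rewrite leNgt nlt.
Qed.

Definition dfinitely_supported M (x : D) :=
  forall i, finitely_supported M (x i).

Definition dforward_shift M n (x : D) : D :=
  fun i => forward_shift (e i) M n (x i).

(** Truncating every summand at the same [M] converges to [x], summand by summand, by the basis
    expansions. *)
Lemma dense_dfinitely_supported :
  dense [set x : D | exists M, dfinitely_supported M x].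
Proof.
move=> U [x Ux] oU.
have xU : nbhs x U by exact: open_nbhs_nbhs.
have : ((fun i => truncation (e i) M (x i)) : D) @[M --> \oo] --> x.
  by apply: direct_sum_cvg => i; have [_ /(_ (x i))] := he i.
move=> /(_ U xU)[M _ /(_ M (leqnn M)) UM].
exists (fun i => truncation (e i) M (x i)); split => //; exists M => i.
exact: truncation_finitely_supported.
Qed.

Lemma dforward_shift_cvg0 M (x : D) :
  dforward_shift M n x @[n --> small_units_filter] --> (0 : D).
Proof.
apply: direct_sum_cvg => i; apply: forward_shift_cvg0 => m.
exact: unit_cvg0.
Qed.

Lemma add_dforward_shift_cvg M (x y : D) :
  x + dforward_shift M n y @[n --> small_units_filter] --> x.
Proof.
apply: direct_sum_cvg => i; rewrite -[X in _ --> X]addr0.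
apply: cvg_tvsD; first exact: cvg_cst.
by apply: forward_shift_cvg0 => m; exact: unit_cvg0.
Qed.

Lemma iter_dforward_shift M n (x : D) :
  dfinitely_supported M x -> iter n BB (dforward_shift M n x) = x.
Proof.
move=> xM; apply: functional_extensionality_dep => i.
rewrite iter_direct_sum_map.
exact: (iter_shift_forward_shift (he i) (hB i)).
Qed.

Lemma iter_direct_sum_shift_eq0 M n (x : D) :
  dfinitely_supported M x -> (M <= n)%N -> iter n BB x = 0.
Proof.
move=> xM Mn; apply: functional_extensionality_dep => i.
by rewrite iter_direct_sum_map (iter_shift_eq0 (hB i) (xM i)).
Qed.

Lemma iter_direct_sum_shiftD n (x y : D) :
  iter n BB (x + y) = iter n BB x + iter n BB y.
Proof.
apply: functional_extensionality_dep => i.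
by rewrite iter_direct_sum_map (iter_shiftD (hB i)) -!iter_direct_sum_map.
Qed.

(** * Passage between the filter of small units and the family *)

Variable F : set (set nat).
Hypothesis hF : furstenberg_family F.

Let FS A C : F A -> A `<=` C -> F C. Proof. by case: hF => _ _; apply. Qed.

Lemma transitive_small_units (eps : R) N :
  F_transitive F BB -> 0 < eps -> F (small_units eps N).
Proof.
move=> trF e0; have [W [V [W0 [y Vy] WVP]]] := return_small_units N e0.
have FWV := trF _ _ (open_interior W) (ex_intro _ 0 W0)
  (open_interior V) (ex_intro _ y Vy).
apply: (FS FWV) => n [_ [[w Ww <-] Vw]].
by apply: (WVP n w); exact: interior_subset.
Qed.

Lemma mixing_criterion_small_units (eps : R) N :
  F_mixing_criterion F BB -> 0 < eps -> F (small_units eps N).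
Proof.
move=> [X0 [Y0 [S [dX0 dY0 critP]]]] e0.
have [W [V [W0 [y Vy] WVP]]] := return_small_units N e0.
have [x [_ X0x]] : ([set: D] `&` X0) !=set0.
  by apply: dX0; [exists 0|exact: openT].
(* Taking [y0] in the interior of [V] makes [V] a neighborhood of the limit of the third component
   in the criterion. *)
have [y0 [Vy0 Y0y0]] : (interior V `&` Y0) !=set0.
  by apply: dY0; [exists y|exact: open_interior].
have := critP x y0 X0x Y0y0 (setT `*` W `*` V) _.
have nT : nbhs ((0, 0, y0) : D * D * D) (setT `*` W `*` V).
  exists (setT `*` W, V) => //; split => //.
  by exists (setT, W) => //; split => //; exact: filterT.
move=> /(_ nT) FWV; apply: (FS FWV) => n /= [[_ Wn] Vn].
exact: (WVP n (S n y0)).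
Qed.

Hypothesis k0 : (0 < k)%N.
Hypothesis F_small :
  forall (eps : R) N, 0 < eps -> (0 < N)%N -> F (small_units eps N).

(** A family need not be closed under intersections, so limits are first combined inside the filter
    and only the resulting set is transferred to [F]. *)
Lemma small_units_filter_family A : small_units_filter A -> F A.
Proof. by move=> [[eps N] /= [e0 N0]] /FS; apply; exact: F_small. Qed.

Lemma small_units_mixing_criterion : F_mixing_criterion F BB.
Proof.
pose Y := [set x : D | exists M, dfinitely_supported M x].
(* The maps [S n] see only [y], so a support bound is chosen as a function of [y], with default [0]
   off [Y]. *)
have /choice[deg degP] (y : D) : exists M, Y y -> dfinitely_supported M y.
  have [[M yM]|yY] := pselect (Y y); first by exists M.
  by exists 0%N.
exists Y, Y, (fun n y => dforward_shift (deg y) n y).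
have dY : dense Y := dense_dfinitely_supported.
split => // x y [M xM] /degP ydeg U nU; apply: small_units_filter_family.
suff : (iter n BB x, dforward_shift (deg y) n y,
    iter n BB (dforward_shift (deg y) n y)) @[n --> small_units_filter] -->
    ((0, 0, y) : D * D * D) by apply.
(* The first component is eventually exactly [0], the second tends to [0], and the third is
   constantly [y]. *)
apply: cvg_pair_nbhs; first apply: cvg_pair_nbhs.
- move=> A A0.
  suff : \forall n \near small_units_filter, A (iter n BB x) by [].
  apply: filterS (small_units_filter_ge k0 M) => n Mn.
  by rewrite (iter_direct_sum_shift_eq0 xM)//; exact: nbhs_singleton.
- exact: dforward_shift_cvg0.
- move=> A Ay.
  suff : \forall n \near small_units_filter,
      A (iter n BB (dforward_shift (deg y) n y)) by [].
  apply: filterE => n; rewrite (iter_dforward_shift n ydeg).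
  exact: nbhs_singleton.
Qed.

Lemma iter_pair_map (T : Type) (f : T -> T) n p :
  iter n (fun p : T * T => (f p.1, f p.2)) p = (iter n f p.1, iter n f p.2).
Proof. by elim: n => [|n /= ->//]; case: p. Qed.

Lemma small_units_mixing : F_mixing F BB.
Proof.
have dY := dense_dfinitely_supported.
have fin2 (U : set (D * D)) : open U -> U !=set0 -> exists x1 x2 M,
    [/\ U (x1, x2), dfinitely_supported M x1 & dfinitely_supported M x2].
  move=> oU [p Up].
  have [[A1 A2] /= [pA1 pA2] A12] : nbhs p U by exact: open_nbhs_nbhs.
  have [x1 [Ax1 [M1 xM1]]] :=
    dY (interior A1) (ex_intro _ p.1 pA1) (open_interior A1).
  have [x2 [Ax2 [M2 xM2]]] :=
    dY (interior A2) (ex_intro _ p.2 pA2) (open_interior A2).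
  exists x1, x2, (maxn M1 M2); split.
  - by apply: A12; split; exact: interior_subset.
  - by move=> i n; rewrite geq_max => /andP[M1n _]; exact: xM1.
  - by move=> i n; rewrite geq_max => /andP[_ M2n]; exact: xM2.
move=> U V oU U0 oV V0; apply: small_units_filter_family.
have [x1 [x2 [M [Ux x1M x2M]]]] := fin2 U oU U0.
have [y1 [y2 [L [Vy y1L y2L]]]] := fin2 V oV V0.
have zU : \forall n \near small_units_filter,
    U (x1 + dforward_shift L n y1, x2 + dforward_shift L n y2).
  have zx : (x1 + dforward_shift L n y1, x2 + dforward_shift L n y2)
      @[n --> small_units_filter] --> (x1, x2).
    by apply: cvg_pair_nbhs; exact: add_dforward_shift_cvg.
  by apply: zx; exact: open_nbhs_nbhs.
(* Intersect two filter events: the perturbed pair lies in [U], and [M <= n] annihilates [x1] and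
   [x2], so the iterate is exactly [(y1, y2)]. *)
apply: filterS2 zU (small_units_filter_ge k0 M) => n Un Mn.
exists (y1, y2); split=> //.
exists (x1 + dforward_shift L n y1, x2 + dforward_shift L n y2) => //.
rewrite iter_pair_map /= !iter_direct_sum_shiftD !iter_dforward_shift//.
rewrite (iter_direct_sum_shift_eq0 x1M)// (iter_direct_sum_shift_eq0 x2M)//.
by rewrite !add0r.
Qed.

End Shifts.

(** Apply mixing to the cylinders over [U] and [V] in the first factor, then project the returning
    pair. *)
Lemma F_mixing_transitive (F : set (set nat)) (T : topologicalType)
    (f : T -> T) : furstenberg_family F -> F_mixing F f -> F_transitive F f.
Proof.
move=> [_ _ FS] mixF U V oU [u Uu] oV [v Vv].
have open_fst A : open A -> open ((fun p : T * T => p.1) @^-1` A).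
  by move=> oA; apply: open_comp => // p _; exact: cvg_fst.
apply: FS (mixF _ _ (open_fst U oU) _ (open_fst V oV) _) _.
- by exists (u, u).
- by exists (v, v).
move=> n [_ [[p Up <-] Vp]]; exists (iter n f p.1); split.
  by exists p.1.
by move: Vp; rewrite /= iter_pair_map.
Qed.

Theorem theorem5p4 (R : realType) (K : numFieldType)
    (hK : real_or_complex R K)
    (k : nat) (hk : (0 < k)%N)
    (X : 'I_k -> frechet_seq_space R K)
    (e : forall i : 'I_k, nat -> X i)
    (he : forall i : 'I_k, canonical_basis (e i))
    (B : forall i : 'I_k, X i -> X i)
    (hB : forall i : 'I_k, backward_shift (B i))
    (F : set (set nat)) (hF : furstenberg_family F) :
  [<-> F_transitive F (direct_sum_map B);
       F_mixing F (direct_sum_map B);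
       F_mixing_criterion F (direct_sum_map B);
       forall (eps : R) (N : nat), 0 < eps -> (0 < N)%N ->
         F (\bigcap_(j in [set j : nat | (j <= N)%N])
              \bigcap_(i in [set: 'I_k]) C_set (e i) eps j)].
Proof.
have small_of_trans : F_transitive F (direct_sum_map B) ->
    forall (eps : R) N, 0 < eps -> (0 < N)%N -> F (small_units e eps N).
  by move=> trF eps N e0 _; exact: (transitive_small_units he hB hF N trF e0).
(* The implications form a cycle, but those leaving the first two assertions pass through the
   fourth, and the last one passes through mixing. *)
tfae.
- by move=> /small_of_trans; exact: small_units_mixing.
- move=> /(F_mixing_transitive hF)/small_of_trans.
  exact: small_units_mixing_criterion.
- by move=> crit eps N e0 _; exact: (mixing_criterion_small_units he hB hF N crit e0).
- move=> small; apply: (F_mixing_transitive hF).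
  exact: (small_units_mixing he hB hF hk small).
Qed.
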